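(* Let $(X,K,\|\cdot\|)$ be a real ordered Banach space whose closed cone $K$ is normal and satisfies $\mathrm{int}(K)\neq\varnothing$. Let $\{S_t\}_{t\ge 0}$ be a positive $C_0$-semigroup of operators in $L(X)$ such that 1) for each vector $x\in K$, $x\ne 0$, there exists a number $t_x\in[0,+\infty)$ such that $S_{t_x}(x)\in \mathrm{int}(K)$; 2) for each vector $x\in K$ its trajectory $\{S_t(x)\}_{t\ge 0}$ is relatively compact in $X$. Then the family $\{S_t\}_{t\ge0}$ converges pointwise (i.e. in norm at each $x\in X$) for $t\to+\infty$ to some operator $A_0\in L(X)$. If $A_0$ is not the zero operator, then there exist a vector $u\in \mathrm{int}(K)$ and a functional $f_0\in K'$, $f_0\ne 0$, such that (i) $S_t(u)=u$ and $S_t^*(f_0)=f_0$ for any $t\ge 0$, and moreover $f_0(x)>0$ if $x\in K$, $x\neq 0$; (ii) $A_0=f_0\otimes u$; (iii) for each $f\in X'$ one has $S_t^*(f)\to A_0^*(f)$ as $t\to\infty$ with respect to the weak*-topology $\sigma(X',X)$; (iv) $\lambda=1$ is a simple eigenvalue of the operators $S_t$ and $S_t^*$ for all $t>0$.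
   Context: A cone $K$ in a real vector space is a nonempty subset with $\lambda x+\mu y\in K$ for $x,y\in K$, $\lambda,\mu\ge 0$, and such that $x,-x\in K$ implies $x=0$. An ordered Banach space $(X,K,\|\cdot\|)$ is a real Banach space $X$ ordered by a closed cone $K$ ($x\le y$ iff $y-x\in K$). $K$ is normal if there is $\delta>0$ with $\|x+y\|\ge\delta\max\{\|x\|,\|y\|\}$ for all $x,y\in K$. $\mathrm{int}(K)$ is the norm interior of $K$. $X'$ is the dual of $X$ and $K'=\{f\in X': f(x)\ge 0 \text{ for all } x\in K\}$. $L(X)$ is the space of continuous linear operators on $X$; $A\in L(X)$ is positive if $A(K)\subset K$; $A^*$ is its adjoint on $X'$. A positive $C_0$-semigroup is a family $\{S_t\}_{t\ge0}\subset L(X)$ of positive operators with $S_0=I$, $S_{s+t}=S_sS_t$ for $s,t\ge0$, and $t\mapsto S_t(x)$ norm-continuous on $[0,+\infty)$ for each $x\in X$. For $f\in X'$, $u\in X$, $f\otimes u$ is the operator $x\mapsto f(x)u$. An eigenvalue is called simple if its eigenspace is one-dimensional. *)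

(* Defs.v *)
From HB Require Import structures.
From mathcomp Require Import all_boot all_order all_algebra.
From mathcomp Require Import all_classical all_reals all_analysis.

Set Implicit Arguments.
Unset Strict Implicit.
Unset Printing Implicit Defensive.

Import Order.TTheory GRing.Theory Num.Theory.
Import numFieldNormedType.Exports.
Local Open Scope classical_set_scope.
Local Open Scope ring_scope.

HB.structure Definition ContLinear (R : realType) (V W : normedModType R) :=
  {f of @GRing.Linear R V W *:%R f & @Continuous V W f}.

Notation "{ 'clinear' V -> W }" := (@ContLinear.type _ V%type W%type)
  (at level 0, V at level 69, format "{ 'clinear'  V  ->  W }") : type_scope.

Definition clinear {R : realType} {V W : normedModType R} : {pred V -> W} :=
  mem [set f : V -> W | linear f /\ continuous f].

Section clinear_lmodType.
Context {R : realType} {V W : normedModType R}.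
Local Notation L := {clinear V -> W}.
Implicit Types f g : V -> W.

Definition clinear_pack f (lf : linear f) (cf : continuous f) : L :=
  HB.pack f (GRing.isLinear.Build _ _ _ _ f lf) (isContinuous.Build V W f cf).

Lemma clinear_inP f : f \in clinear -> linear f /\ continuous f.
Proof. by rewrite inE. Qed.

Definition clinear_Sub f (fL : f \in clinear) : L :=
  clinear_pack (clinear_inP fL).1 (clinear_inP fL).2.

Lemma clinear_mem (A : L) : (A : V -> W) \in clinear.
Proof. by rewrite inE; split; [exact: linearP | exact: cts_fun]. Qed.

Lemma clinear_eq (A B : L) : A =1 B -> A = B.
Proof.
move=> AB; have {AB} : (A : V -> W) = B by exact/funext.
case: A B => [f [[cf] [lf] [sf]]] [g [[cg] [lg] [sg]]] /= fg; subst g.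
by rewrite (Prop_irrelevance cg cf) (Prop_irrelevance lg lf)
           (Prop_irrelevance sg sf).
Qed.

Lemma clinear_rect (K : L -> Type) :
  (forall f (fL : f \in clinear), K (clinear_Sub fL)) -> forall A : L, K A.
Proof.
move=> KSub A; suff -> : A = clinear_Sub (clinear_mem A) by exact: KSub.
exact: clinear_eq.
Qed.

Lemma clinear_valP f (fL : f \in clinear) : clinear_Sub fL = f :> (V -> W).
Proof. by []. Qed.

HB.instance Definition _ := isSub.Build _ _ L clinear_rect clinear_valP.
HB.instance Definition _ := [Choice of L by <:].

Lemma clinear_submod_closed : submod_closed (@clinear R V W).
Proof.
split=> [|a f g /clinear_inP[lf cf] /clinear_inP[lg cg]]; rewrite inE.
  by split; [exact: (linearP (\0 : {linear V -> W})) | exact: cst_continuous].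
split=> [b x y|x].
  by rewrite /= !fctE lf lg !scalerDr !scalerA (mulrC a) addrACA.
by apply: cvgD; [apply: cvgZr; exact: cf | exact: cg].
Qed.
HB.instance Definition _ :=
  GRing.isSubmodClosed.Build R (V -> W) clinear clinear_submod_closed.
HB.instance Definition _ := [SubChoice_isSubLmodule of L by <:].

End clinear_lmodType.

HB.instance Definition _ (R : realType) (U V W : normedModType R)
    (A : {clinear U -> V}) (B : {clinear V -> W}) :=
  Continuous.on (B \o A).
HB.instance Definition _ (R : realType) (V : normedModType R) :=
  Continuous.on (@idfun V).

Section operators.
Context {R : realType} {X : normedModType R}.
Implicit Types (A : {clinear X -> X}) (f : {clinear X -> R^o}) (u : X).

Definition adjoint A f : {clinear X -> R^o} := f \o A.

Lemma adjoint_is_linear A : linear (adjoint A).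
Proof. by move=> a f g; apply: clinear_eq. Qed.
HB.instance Definition _ A :=
  GRing.isLinear.Build R {clinear X -> R^o} {clinear X -> R^o} *:%R
    (adjoint A) (adjoint_is_linear A).

Lemma tensor_is_linear f u : linear (fun x => f x *: u).
Proof. by move=> a x y; rewrite linearP scalerDl -scalerA. Qed.

Lemma tensor_continuous f u : continuous (fun x => f x *: u).
Proof. by move=> x; apply: cvgZl; exact: cts_fun. Qed.

Definition tensor f u : {clinear X -> X} :=
  clinear_pack (@tensor_is_linear f u) (@tensor_continuous f u).

(* The topology sigma(X', X): the coarsest one on X' for which every
   evaluation f |-> f x is continuous, i.e. the trace on X' of the topology of
   pointwise convergence. *)
Definition weak_star : Type :=
  initial_topology (fun f => (f : {ptws X -> R^o})).
HB.instance Definition _ := Topological.copy weak_star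
  (initial_topology (fun f : {clinear X -> R^o} => (f : {ptws X -> R^o}))).

End operators.
Arguments weak_star {R} X.

Section cones.
Context {R : realType} {X : normedModType R}.
Implicit Types K : set X.

Definition is_cone K :=
  [/\ K !=set0,
      forall (x y : X) (a b : R),
        K x -> K y -> 0 <= a -> 0 <= b -> K (a *: x + b *: y)
    & forall x, K x -> K (- x) -> x = 0].

Definition normal_cone K :=
  exists2 delta : R, 0 < delta &
    forall x y, K x -> K y -> delta * Num.max `|x| `|y| <= `|x + y|.

Definition dual_cone K : set {clinear X -> R^o} :=
  [set f | forall x, K x -> 0 <= f x].

Definition positive_operator K (A : {clinear X -> X}) := A @` K `<=` K.

(* The parameter ranges over [0, +oo[; the values of S at negative reals are
   irrelevant. *)
Record positive_C0_semigroup K (S : R -> {clinear X -> X}) : Prop := {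
  semigroup_positive : forall t, 0 <= t -> positive_operator K (S t) ;
  semigroup0 : S 0 =1 idfun ;
  semigroupD : forall s t, 0 <= s -> 0 <= t -> S (s + t) =1 S s \o S t ;
  semigroup_continuous : forall x, {within `[0, +oo[, continuous (S ^~ x)}
}.

End cones.

Section eigen.
Context {R : realType} {V : lmodType R}.
Implicit Types (T : V -> V) (a : R).

Definition eigenspace_of T a : set V := [set v | T v = a *: v].

Definition one_dimensional (E : set V) :=
  exists2 v, v != 0 & E = [set c *: v | c in [set: R]].

(* Geometric simplicity. *)
Definition simple_eigenvalue T a :=
  (exists2 v, v != 0 & eigenspace_of T a v) /\
  one_dimensional (eigenspace_of T a).

End eigen.

(* Main.v *)
Require Import Defs.
From HB Require Import structures.
From mathcomp Require Import all_boot all_order all_algebra.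
From mathcomp Require Import all_classical all_reals all_analysis.
From mathcomp Require Import ring.

Set Implicit Arguments.
Unset Strict Implicit.
Unset Printing Implicit Defensive.

Import Order.TTheory GRing.Theory Num.Theory.
Import numFieldNormedType.Exports.
Local Open Scope classical_set_scope.
Local Open Scope ring_scope.

(** Two trajectories are compared through the order.  For vectors [p], [q],
    call [a] admissible if [S t p >= a *: S t q] for some [t >= 0]; by
    positivity the inequality persists at all later times.  Let [a] be the
    supremum of the admissible numbers, and let [w], [z] be the limits of
    [S t p], [S t q] along an ultrafilter finer than the neighbourhoods of
    infinity; they exist because trajectories are relatively compact.
    Closedness of [K] gives [w - a *: z >= 0].  If this difference were not
    zero, strict positivity would push it, at some time [r], into the interior
    of [K], so that [S r w - (a + e) *: S r z] is interior for some [e > 0];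
    by continuity [a + e] would then be admissible.  Hence [w = a *: z]
    ([limits_proportional]).

    Take [q] interior and [p = S s q].  As [S s] commutes with the semigroup,
    the limit [z] of the trajectory of [q] is an eigenvector of every [S s],
    and if [z] is not zero it is interior ([limit_eigenvector],
    [limit_interior]).  Trajectories are bounded, so the eigenvalue is at most
    1; if it is smaller than 1 for some [s], the trajectory of the order unit
    [z] comes close to 0, and it dominates all others.  So either every
    trajectory tends to 0, or there is an interior fixed point [u]
    ([orbit_cvg0_or_fixed]).

    In the second case take [q = u] and let [p = x] be arbitrary: the
    trajectory of [x] has a limit [f x *: u] along the ultrafilter.  This limit
    is a fixed point and the semigroup is bounded, so the convergence holds for
    [t] tending to infinity ([orbit_cvg_fixed]).  The invariance, strict
    positivity and simplicity statements all follow by passing to the limit in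
    identities or inequalities along trajectories. *)

(** * Closed normal cones *)

Section cone_theory.
Context {R : realType} {X : normedModType R} (K : set X).
Context (coneK : is_cone K) (closedK : closed K).

Lemma coneD x y : K x -> K y -> K (x + y).
Proof.
case: coneK => _ KD _ Kx Ky.
by rewrite -[x]scale1r -[y]scale1r; apply: KD.
Qed.

Lemma coneZ a x : 0 <= a -> K x -> K (a *: x).
Proof.
case: coneK => _ KD _ a0 Kx.
by have := KD x x a 0 Kx Kx a0 (lexx _); rewrite scale0r addr0.
Qed.

Lemma cone0 : K 0.
Proof. by case: coneK => -[x Kx] _ _; rewrite -(scale0r x); apply: coneZ. Qed.

Lemma cone_scale_ge0 a z : K z -> z != 0 -> K (a *: z) -> 0 <= a.
Proof.
move=> Kz z0 Kaz; rewrite leNgt; apply/negP => a0.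
have KNz : K (- z).
  rewrite -[- z](@scalerK _ _ (- a)) ?oppr_eq0 ?lt_eqF//.
  rewrite scalerN scaleNr opprK; apply: coneZ => //.
  by rewrite invr_ge0 oppr_ge0 ltW.
by case: coneK => _ _ /(_ z Kz KNz) zE; rewrite zE eqxx in z0.
Qed.

Lemma cone_archimedean x y : (forall e, 0 < e -> K (x + e *: y)) -> K x.
Proof.
move=> Kxy; pose u (e : R) := x + e *: y.
have uK : \forall e \near 0^'+, K (u e).
  by near=> e; apply: Kxy; near: e; exact: nbhs_right_gt.
have : u e @[e --> 0^'+] --> x + 0 *: y.
  apply: cvgD; first exact: cvg_cst.
  by apply: cvgZr_tmp; exact: cvg_at_right_filter.
by rewrite scale0r addr0; apply: closed_cvg.
Unshelve. all: by end_near. Qed.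

(** A ball of radius [e] about [x] inside [K] yields [c = 2 / e], and [c]
    yields the radius [c^-1].  Thus interior points are order units with a
    constant that is uniform on bounded sets, which links order and norm. *)
Lemma interior_coneP x :
  interior K x <-> exists2 c, 0 < c & forall y, K (c * `|y| *: x - y).
Proof.
split=> [/nbhs_ballP[e /= e0 eK]|[c c0 cK]].
  exists (2 / e) => [|y]; first by rewrite divr_gt0.
  have [->|y0] := eqVneq y 0.
    by rewrite normr0 mulr0 scale0r subr0; exact: cone0.
  have ny : 0 < `|y| by rewrite normr_gt0.
  have {eK} K1 : K (x - (e / 2 / `|y|) *: y).
    apply: eK; rewrite -ball_normE /ball_ /= opprB addrC subrK normrZ.
    rewrite ger0_norm ?divr_ge0 ?ltW// divfK ?gt_eqF//.
    by rewrite ltr_pdivrMr// ltr_pMr// ltr1n.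
  have /coneZ : 0 <= 2 / e * `|y| by rewrite mulr_ge0// divr_ge0// ltW.
  move=> /(_ _ K1); rewrite scalerBr scalerA.
  rewrite (_ : 2 / e * `|y| * (e / 2 / `|y|) = 1) ?scale1r//.
  by field; rewrite ?gt_eqF.
have Kx : K x.
  have := cK (- x); rewrite opprK normrN -[X in _ + X]scale1r -scalerDl.
  move=> /coneZ -/(_ (c * `|x| + 1)^-1).
  have c1 : 0 < c * `|x| + 1 by rewrite ltr_wpDl// mulr_ge0// ltW.
  by rewrite scalerK ?gt_eqF//; apply; rewrite invr_ge0 ltW.
apply/nbhs_ballP; exists c^-1; rewrite /= ?invr_gt0// => y.
rewrite -ball_normE /ball_ /= => xy.
rewrite (_ : y = (c * `|x - y| *: x - (x - y)) + (1 - c * `|x - y|) *: x).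
  apply: coneD => //; apply: coneZ => //.
  by rewrite subr_ge0 mulrC -ler_pdivlMr// div1r ltW.
by rewrite scalerBl scale1r opprB [RHS]addrC addrA subrK [RHS]addrC subrK.
Qed.

Lemma interior_coneZ a x : 0 < a -> interior K x -> interior K (a *: x).
Proof.
move=> a0 /interior_coneP[c c0 cK]; apply/interior_coneP.
exists (c / a) => [|y]; first by rewrite divr_gt0.
by rewrite scalerA mulrAC divfK ?gt_eqF.
Qed.

Lemma interior_cone_subZ x y : interior K x ->
  exists2 e, 0 < e & interior K (x - e *: y).
Proof.
move=> Kx; have cv : x - e *: y @[e --> 0^'+] --> x - 0 *: y.
  apply: cvgB; first exact: cvg_cst.
  by apply: cvgZr_tmp; exact: cvg_at_right_filter.
rewrite scale0r subr0 in cv.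
have : \forall e \near 0^'+, interior K (x - e *: y).
  apply: (cv (interior K)); apply: open_nbhs_nbhs.
  by split => //; exact: open_interior.
move=> H; have : \forall e \near 0^'+, 0 < e /\ interior K (x - e *: y).
  by near=> e; split; near: e => //; exact: nbhs_right_gt.
by move=> /filter_ex[e []]; exists e.
Unshelve. all: by end_near. Qed.

(** Order intervals [[-v, v]] are norm bounded: normality bounds [v + y] by
    the sum [(v + y) + (v - y)]. *)
Lemma normal_cone_interval : normal_cone K ->
  exists2 C, 0 < C & forall v y, K (v + y) -> K (v - y) -> `|y| <= C * `|v|.
Proof.
case=> d d0 dK; exists (2 / d + 1) => [|v y Kp Km].
  by rewrite ltr_wpDl// divr_ge0// ltW.
have := dK _ _ Kp Km; rewrite addrACA subrr addr0 => H.
have {}H : `|v + y| <= 2 / d * `|v|.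
  rewrite mulrAC ler_pdivlMr// mulrC.
  apply: (le_trans _ (le_trans H _)).
    by rewrite ler_wpM2l ?(ltW d0)// le_max lexx.
  by rewrite -mulr2n normrMn mulr_natl.
rewrite mulrDl mul1r (_ : y = (v + y) - v); last by rewrite addrC addKr.
by apply: (le_trans (ler_normB _ _)); rewrite lerD2r.
Qed.

End cone_theory.

(** * Limits along ultrafilters and at infinity *)

(** A cluster point of an ultrafilter is a limit of it. *)
Lemma precompact_ultra_cvg {R : realType} {X : normedModType R} {T : Type}
    (U : set_system T) (f : T -> X) (A : set X) :
  UltraFilter U -> precompact A -> (\forall t \near U, A (f t)) ->
  exists l : X, f t @[t --> U] --> l.
Proof.
move=> UU; rewrite precompactE => cA UA.
have [l [_ lU]] : closure A `&` cluster (fmap f U) !=set0.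
  by apply: cA; apply: filterS UA => t; exact: subset_closure.
exists l => B lB; have [//|UB] := in_ultra_setVsetC (f @^-1` B) UU.
have [x [xB Bx]] := lU (~` B) B UB lB; contradiction.
Qed.

Lemma exprn_small {R : archiRealFieldType} (d eps : R) :
  0 <= d < 1 -> 0 < eps -> exists n, d ^+ n < eps.
Proof.
move=> /andP[d0 d1] eps0.
have dn0 : (GRing.exp d : R ^nat) @ \oo --> 0.
  by apply: cvg_expr; rewrite ger0_norm.
move/cvgrPdist_lt: dn0 => /(_ eps eps0)/filter_ex[n].
by rewrite sub0r normrN ger0_norm ?exprn_ge0//; exists n.
Qed.

Lemma pinfty_ge0 {R : realType} : \forall t \near +oo_R, 0 <= t.
Proof. by apply: nbhs_pinfty_ge; exact: num_real. Qed.

Lemma scaler_left_inj {R : realType} {V : lmodType R} (u : V) (a b : R) :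
  u != 0 -> a *: u = b *: u -> a = b.
Proof.
move=> u0 /eqP; rewrite -subr_eq0 -scalerBl scaler_eq0 (negbTE u0) orbF.
by rewrite subr_eq0 => /eqP.
Qed.

(** [weak_star X] carries the trace of the topology of pointwise
    convergence. *)
Lemma weak_star_cvg {R : realType} {X : normedModType R} {T : Type}
    (F : set_system T) (g : T -> {clinear X -> R^o}) (f : {clinear X -> R^o}) :
  Filter F -> (forall x, g t x @[t --> F] --> f x) ->
  (g t : weak_star X) @[t --> F] --> (f : weak_star X).
Proof.
move=> FF gf.
have gf' : (g t : {ptws X -> R^o}) @[t --> F] --> (f : {ptws X -> R^o}).
  by apply: (@pointwise_cvgP X R^o _ _ _).2 => x; exact: gf.
move=> B /= [_ [[C oC <-] Cf] CB].
have FC := gf' C (open_nbhs_nbhs (conj oC Cf)).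
by apply: (@filterS _ F FF _ _ _ FC) => t; exact: CB.
Qed.

(** * Trajectories of a positive semigroup *)

Section semigroup.
Context {R : realType} {X : normedModType R} (K : set X)
  (S : R -> {clinear X -> X}).
Context (coneK : is_cone K) (normalK : normal_cone K)
  (semiS : positive_C0_semigroup K S).

Lemma orbitD s t x : 0 <= s -> 0 <= t -> S (s + t) x = S s (S t x).
Proof. by move=> s0 t0; exact: semigroupD semiS s t s0 t0 x. Qed.

Lemma orbit_cone t x : 0 <= t -> K x -> K (S t x).
Proof. by move=> t0 Kx; apply: (semigroup_positive semiS t0); exists x. Qed.

Lemma orbit_cone_le s t x a y : 0 <= s -> s <= t ->
  K (S s x - a *: S s y) -> K (S t x - a *: S t y).
Proof.
move=> s0 st /(orbit_cone (t := t - s)); rewrite subr_ge0 => /(_ st).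
by rewrite linearB linearZ/= -!orbitD ?subr_ge0// subrK.
Qed.

Lemma orbit_iter s z c n : 0 <= s -> S s z = c *: z ->
  S (s *+ n) z = c ^+ n *: z.
Proof.
move=> s0 sz; elim: n => [|n IH].
  by rewrite mulr0n expr0 scale1r (semigroup0 semiS).
by rewrite mulrS orbitD ?mulrn_wge0// IH linearZ/= sz scalerA exprSr.
Qed.

(** Applied to [c * `|x| *: e + x] and [c * `|x| *: e - x], both in [K], the
    operator [S t] shows that [S t x] lies in the order interval of radius
    [c * `|x| *: S t e]. *)
Lemma orbit_le_unit e : interior K e -> exists2 C, 0 < C &
  forall t x, 0 <= t -> `|S t x| <= C * `|x| * `|S t e|.
Proof.
move=> /(interior_coneP coneK)[c c0 cK].
have [C C0 CK] := normal_cone_interval normalK.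
exists (C * c) => [|t x t0]; first exact: mulr_gt0.
have /(orbit_cone t0) := cK x; have /(orbit_cone t0) := cK (- x).
rewrite opprK normrN linearD linearB/= linearZ/= => Kp Km.
apply: (le_trans (CK _ _ Kp Km)).
by rewrite normrZ normrM normr_id gtr0_norm// !mulrA.
Qed.

End semigroup.

Section compact_orbits.
Context {R : realType} {X : normedModType R} (K : set X)
  (S : R -> {clinear X -> X}).
Context (coneK : is_cone K) (closedK : closed K) (normalK : normal_cone K)
  (intK : interior K !=set0) (semiS : positive_C0_semigroup K S)
  (strictS : forall x, K x -> x <> 0 ->
     exists2 t : R, 0 <= t & interior K (S t x))
  (compactS : forall x, K x -> precompact [set S t x | t in `[0, +oo[]).

Lemma orbits_bounded : exists2 M, 0 < M &
  forall t x, 0 <= t -> `|S t x| <= M * `|x|.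
Proof.
case: intK => e Ke; have [C C0 CS] := orbit_le_unit coneK normalK semiS Ke.
have := compactS (interior_subset Ke); rewrite precompactE => /compact_bounded.
move=> [M0 [_ MS]]; pose M := `|M0| + 1.
have M0M : M0 < M by rewrite ltr_pwDr// ler_norm.
exists (C * M) => [|t x t0]; first by rewrite mulr_gt0// ltr_wpDl.
apply: (le_trans (CS _ _ t0)).
rewrite mulrAC ler_wpM2r// ler_wpM2l//; first exact: ltW.
apply: (MS M M0M); apply: subset_closure; exists t => //.
by rewrite /= in_itv/= t0.
Qed.

(** [S (s - t)] maps [S t x - l] to [S s x - l], so that closeness to [l] at
    a single time [t] persists, up to the factor [M], at all times [s >= t]. *)
Lemma orbit_cvg_near l x : (forall t, 0 <= t -> S t l = l) ->
  (forall eps, 0 < eps -> exists2 t, 0 <= t & `|S t x - l| < eps) ->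
  S t x @[t --> +oo] --> l.
Proof.
move=> Sl near_l; have [M M0 MS] := orbits_bounded.
apply/cvgrPdist_lt => eps eps0.
have [|t t0 tl] := near_l (eps / M); first exact: divr_gt0.
near=> s; have ts : t <= s by near: s; apply: nbhs_pinfty_ge; exact: num_real.
rewrite distrC -(subrK t s) (orbitD semiS) ?subr_ge0//.
rewrite -[in X in _ - X](Sl (s - t)) ?subr_ge0// -linearB.
apply: (le_lt_trans (MS _ _ _)); rewrite ?subr_ge0//.
by rewrite mulrC -ltr_pdivlMr.
Unshelve. all: by end_near. Qed.

Lemma orbit_cvg0 e : interior K e ->
  (forall eps, 0 < eps -> exists2 t, 0 <= t & `|S t e| < eps) ->
  forall x, S t x @[t --> +oo] --> (0 : X).
Proof.
move=> Ke small x; have [C C0 CS] := orbit_le_unit coneK normalK semiS Ke.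
apply: orbit_cvg_near => [t _|eps eps0]; first exact: linear0.
have C1 : 0 < C * `|x| + 1 by rewrite ltr_wpDl// mulr_ge0// ltW.
have [|t t0 te] := small (eps / (C * `|x| + 1)); first exact: divr_gt0.
exists t => //; rewrite subr0; apply: (le_lt_trans (CS _ _ t0)).
have [->|te0] := eqVneq (S t e) 0; first by rewrite normr0 mulr0.
rewrite ltr_pdivlMr// mulrC in te; apply: le_lt_trans te.
by rewrite ler_wpM2r// lerDl.
Qed.

(** * Comparison of trajectories *)

Section ultra.
Context (U : set_system R) (UU : UltraFilter U) (oo_U : nbhs +oo_R `<=` U).

Lemma ultra_ge0 : \forall t \near U, 0 <= t.
Proof. exact: oo_U pinfty_ge0. Qed.

Lemma ultra_ge0_ex (P : set R) : (\forall t \near U, P t) ->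
  exists2 t, 0 <= t & P t.
Proof.
move=> UP; have FU := @ultra_proper _ _ UU.
by have /filter_ex[t []] := @filterI _ U FU _ _ ultra_ge0 UP; exists t.
Qed.

(** Compactness is given on [K] only, but an order unit [e] writes every [x]
    as a difference of two elements of [K]. *)
Lemma orbit_ultra_cvg x : exists l : X, S t x @[t --> U] --> l.
Proof.
have cvgK y : K y -> exists l : X, S t y @[t --> U] --> l.
  move=> Ky; apply: (precompact_ultra_cvg _ (compactS Ky)).
  by apply: filterS ultra_ge0 => t t0; exists t; rewrite //= in_itv/= t0.
case: intK => e Ke; have /(interior_coneP coneK)[c c0 cK] := Ke.
have cx0 : 0 <= c * `|x| by rewrite mulr_ge0// ltW.
have [l1 el1] := cvgK _ (coneZ coneK cx0 (interior_subset Ke)).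
have [l2 el2] := cvgK _ (cK x).
exists (l1 - l2).
rewrite (_ : (fun t => S t x) =
  (fun t => S t (c * `|x| *: e)) \- (fun t => S t (c * `|x| *: e - x))).
  exact: cvgB.
by apply/funext => t /=; rewrite -linearB opprB addrC subrK.
Qed.

Lemma orbit_cvg_ultra l x : (forall t, 0 <= t -> S t l = l) ->
  S t x @[t --> U] --> l -> S t x @[t --> +oo] --> l.
Proof.
move=> Sl /cvgrPdist_lt xl; apply: orbit_cvg_near => // eps eps0.
have [t t0 tl] := ultra_ge0_ex (xl _ eps0).
by exists t => //; rewrite distrC.
Qed.

Lemma orbit_limit_cone x z : K x -> S t x @[t --> U] --> z -> K z.
Proof.
move=> Kx xz; apply: (closed_cvg K closedK _ _ xz).
by apply: filterS ultra_ge0 => t t0; exact: (orbit_cone semiS).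
Qed.

(** The best constant in [S t p >= a *: S t q] is attained in the limit, and
    strict positivity of the semigroup excludes any slack there. *)
Lemma limits_proportional p q w z : interior K q -> z != 0 ->
  S t q @[t --> U] --> z -> S t p @[t --> U] --> w -> exists a, w = a *: z.
Proof.
move=> Kq z0 qz pw.
have comb a : S t p - a *: S t q @[t --> U] --> w - a *: z.
  by apply: cvgB => //; exact: cvgZl_tmp.
have Kz := orbit_limit_cone (interior_subset Kq) qz.
(* Since q is an order unit, some multiples of q lie below and above p; so L
   is nonempty and bounded. *)
pose L := [set a | exists2 t, 0 <= t & K (S t p - a *: S t q)].
have LK a : L a -> K (w - a *: z).
  case=> t t0 Kt; apply: (closed_cvg K closedK _ _ (comb a)).
  have := @nbhs_pinfty_ge _ t (num_real t) => /oo_U.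
  by apply: filterS => s ts; apply: (orbit_cone_le semiS t0).
have /(interior_coneP coneK)[c c0 cK] := Kq.
have L0 : L !=set0.
  exists (- (c * `|p|)); exists 0 => //; rewrite !(semigroup0 semiS)/=.
  by have := cK (- p); rewrite normrN opprK scaleNr opprK addrC.
have Lub : ubound L (c * `|p|).
  move=> a /LK Kwa; rewrite -subr_ge0.
  apply: (cone_scale_ge0 coneK Kz z0); rewrite scalerBl.
  rewrite -(subrK w (c * `|p| *: z)) -addrA; apply: (coneD coneK) => //.
  have -> : c * `|p| *: z - w = - (w - c * `|p| *: z) by rewrite opprB.
  apply: (closed_cvg K closedK _ _ (cvgN (comb (c * `|p|)))).
  apply: filterS ultra_ge0 => t t0 /=; rewrite opprB.
  by have := orbit_cone semiS t0 (cK p); rewrite linearB linearZ.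
have Lsup : has_sup L by split => //; exists (c * `|p|).
pose a := reals.sup L; exists a; apply/eqP; rewrite -subr_eq0.
have Kv : K (w - a *: z).
  apply: (cone_archimedean closedK (y := z)) => e e0.
  have [b Lb ab] := sup_adherent e0 Lsup.
  rewrite -addrA -scaleNr -scalerDl.
  rewrite (_ : w + _ = (w - b *: z) + (b - (a - e)) *: z).
    by apply: (coneD coneK) (LK _ Lb) (coneZ coneK _ Kz); rewrite subr_ge0 ltW.
  by rewrite -addrA -scaleNr -scalerDl; congr (_ + _ *: _); rewrite /a; ring.
(* If the slack w - a z were not zero, some a + e would belong to L. *)
apply/negPn/negP => /eqP v0; have [r r0 Kr] := strictS Kv v0.
have [e e0 Ke] := interior_cone_subZ (S r z) Kr.
have cvr : S r (S t p - (a + e) *: S t q) @[t --> U] -->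
    S r (w - (a + e) *: z).
  apply: (@continuous_cvg _ _ _ U _ (fun t => S t p - (a + e) *: S t q)).
    exact: cts_fun.
  exact: comb.
have Kre : interior K (S r (w - (a + e) *: z)).
  by rewrite scalerDl opprD addrA linearB [X in _ - X]linearZ.
have /cvr /= := open_nbhs_nbhs (conj (open_interior K) Kre).
move=> /ultra_ge0_ex[t t0 /interior_subset].
rewrite linearB linearZ/= -!(orbitD semiS)// => Krt.
have : a + e <= a.
  by apply: (sup_ubound Lsup.2); exists (r + t); rewrite ?addr_ge0.
by rewrite gerDl leNgt e0.
Qed.

(** [S s] maps the trajectory of [e] to that of [S s e], so [S s z] and [z]
    are limits of two trajectories along [U]. *)
Lemma limit_eigenvector e z s : interior K e -> z != 0 ->
  S t e @[t --> U] --> z -> 0 <= s -> exists c, S s z = c *: z.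
Proof.
move=> Ke z0 ez s0; apply: (limits_proportional (p := S s e) Ke z0 ez).
have Sez : S s (S t e) @[t --> U] --> S s z.
  exact: @continuous_cvg _ _ _ U _ (S ^~ e) (S s) z (cts_fun z) ez.
apply: cvg_trans Sez; apply: near_eq_cvg.
by apply: filterS ultra_ge0 => t t0 /=; rewrite -!(orbitD semiS)// addrC.
Qed.

(** Some [S r z] is interior by strict positivity, and it is a multiple of
    [z]. *)
Lemma limit_interior e z : interior K e -> z != 0 ->
  S t e @[t --> U] --> z -> interior K z.
Proof.
move=> Ke z0 ez; have Kz := orbit_limit_cone (interior_subset Ke) ez.
have [r r0 Kr] := strictS Kz (elimN eqP z0).
have [c cE] := limit_eigenvector Ke z0 ez r0; rewrite cE in Kr.
have := cone_scale_ge0 coneK Kz z0 (interior_subset Kr).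
rewrite le_eqVlt => /orP[/eqP c0|c0]; last first.
  rewrite -(@scalerK _ _ c _ z) ?gt_eqF//.
  by apply: (interior_coneZ coneK); rewrite ?invr_gt0.
(* An interior point 0 would force - z into the cone. *)
move: Kr; rewrite -c0 scale0r => /(interior_coneP coneK)[d _ /(_ z)].
rewrite scaler0 sub0r; case: coneK => _ _ /(_ z Kz)/[apply] zE.
by rewrite zE eqxx in z0.
Qed.

End ultra.

(** The trajectory of [z] at the times [s *+ n] is [c ^+ n *: z].  It is
    bounded, which excludes [c > 1]; and if [c < 1] it comes close to 0, hence
    so does every trajectory, [z] being an order unit. *)
Lemma interior_eigenvalue1 z s c : interior K z -> z != 0 -> 0 <= s ->
  S s z = c *: z -> c = 1 \/ forall x, S t x @[t --> +oo] --> (0 : X).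
Proof.
move=> Kiz z0 s0 cE; have Kz := interior_subset Kiz.
have c0 : 0 <= c.
  apply: (cone_scale_ge0 coneK Kz z0); rewrite -cE.
  exact: (orbit_cone semiS).
have nz : 0 < `|z| by rewrite normr_gt0.
have [c1|c1|c1] := ltgtP c 1; last by left.
  right; apply: (orbit_cvg0 Kiz) => eps eps0.
  have [|n cn] := @exprn_small _ c (eps / `|z|) _ (divr_gt0 eps0 nz).
    by rewrite c0.
  exists (s *+ n); first exact: mulrn_wge0.
  rewrite (orbit_iter semiS _ s0 cE) normrZ ger0_norm ?exprn_ge0//.
  by rewrite -ltr_pdivlMr.
have [M M0 MS] := orbits_bounded.
have [||n cn] := @exprn_small _ c^-1 M^-1; rewrite ?invr_gt0//.
  by rewrite invr_ge0 c0 invf_lt1 ?(lt_trans ltr01).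
have := MS (s *+ n) z (mulrn_wge0 _ s0).
rewrite (orbit_iter semiS _ s0 cE) normrZ ger0_norm ?exprn_ge0// ler_pM2r//.
have cn0 : 0 < c ^+ n by rewrite exprn_gt0 ?(lt_trans ltr01 c1).
move: cn; rewrite exprVn ltf_pV2 ?posrE//.
by rewrite ltNge => /negbTE ->.
Qed.

Lemma orbit_cvg0_or_fixed :
  (forall x, S t x @[t --> +oo] --> (0 : X)) \/
  exists u, [/\ interior K u, u != 0 & forall t, 0 <= t -> S t u = u].
Proof.
have [U [UU oo_U]] := ultraFilterLemma (@proper_pinfty_nbhs R).
case: intK => e Ke; have [z ez] := orbit_ultra_cvg UU oo_U e.
have [z0|z0] := eqVneq z 0.
  left; apply: (orbit_cvg0 Ke) => eps eps0.
  move/cvgrPdist_lt: ez => /(_ eps eps0)/(ultra_ge0_ex UU oo_U)[t t0].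
  by rewrite z0 sub0r normrN; exists t.
have Kz := limit_interior UU oo_U Ke z0 ez.
have [Sz|] := pselect (forall s, 0 <= s -> S s z = z).
  by right; exists z; split.
move=> /existsNP[s /not_implyP[s0 sz]]; left.
have [c cE] := limit_eigenvector UU oo_U Ke z0 ez s0.
have [c1|//] := interior_eigenvalue1 Kz z0 s0 cE.
by rewrite cE c1 scale1r in sz.
Qed.

(** [u] is its own limit, so the limit of any trajectory is a multiple of it. *)
Lemma orbit_cvg_fixed u : interior K u -> u != 0 ->
  (forall t, 0 <= t -> S t u = u) ->
  forall x, exists a, S t x @[t --> +oo] --> a *: u.
Proof.
move=> Ku u0 Su x.
have [U [UU oo_U]] := ultraFilterLemma (@proper_pinfty_nbhs R).
have uu : S t u @[t --> U] --> u.
  apply: cvg_near_cst.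
  by apply: filterS (ultra_ge0 oo_U) => t t0; rewrite Su.
have [l xl] := orbit_ultra_cvg UU oo_U x.
have [a la] := limits_proportional UU oo_U Ku u0 uu xl.
exists a; rewrite la in xl; apply: (orbit_cvg_ultra UU oo_U _ xl) => t t0.
by rewrite linearZ/= Su.
Qed.

(** * The limit functional *)

(** The coefficient of [u] in the limit is unique because [u] is not zero,
    which makes it linear in [x]; it is continuous because the norm of the
    limit is at most [M * `|x|]. *)
Lemma limit_functional u : interior K u -> u != 0 ->
  (forall t, 0 <= t -> S t u = u) ->
  exists f : {clinear X -> R^o}, forall x, S t x @[t --> +oo] --> f x *: u.
Proof.
move=> Ku u0 Su; have [f fE] := choice (orbit_cvg_fixed Ku u0 Su).
have flin : linear (f : X -> R^o).
  move=> a x y; apply: (scaler_left_inj u0).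
  apply: (cvg_unique (@norm_hausdorff _ X) (fE _)).
  rewrite scalerDl -scalerA.
  rewrite (_ : (fun t => _) = (fun t => a *: S t x) \+ S ^~ y).
    by apply: cvgD; [apply: cvgZl_tmp; exact: fE|exact: fE].
  by apply/funext => t /=; rewrite linearP.
have [M M0 MS] := orbits_bounded.
have nu : 0 < `|u| by rewrite normr_gt0.
have fb x : `|f x| <= M / `|u| * `|x|.
  rewrite mulrAC ler_pdivlMr// -normrZ.
  apply: (closed_cvg _ (@closed_le _ (M * `|x|)) _ _ (cvg_norm (fE x))).
  by apply: filterS pinfty_ge0 => t; exact: MS.
pose fl : {linear X -> R^o} := HB.pack f (GRing.isLinear.Build _ _ _ _ _ flin).
have fcont : continuous (f : X -> R^o).
  apply: (@bounded_linear_continuous _ _ _ fl); apply/linear_boundedP.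
  apply: filterS (nbhs_pinfty_ge (num_real (M / `|u|))) => r Mr x.
  by apply: (le_trans (fb x)); exact: ler_wpM2r.
by exists (clinear_pack flin fcont).
Qed.

Section limit_functional_theory.
Context (u : X) (f : {clinear X -> R^o}).
Context (Ku : interior K u) (u0 : u != 0)
  (Su : forall t, 0 <= t -> S t u = u)
  (fE : forall x, S t x @[t --> +oo] --> f x *: u).

Lemma limit_functional_unit : f u = 1.
Proof.
apply: (scaler_left_inj u0); rewrite scale1r.
apply: (cvg_unique (@norm_hausdorff _ X) (@fE u)); apply: cvg_near_cst.
by apply: filterS pinfty_ge0 => t; exact: Su.
Qed.

Lemma limit_functional_ge0 x b : (forall t, 0 <= t -> K (S t x - b *: u)) ->
  b <= f x.
Proof.
move=> xb; rewrite -subr_ge0.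
apply: (cone_scale_ge0 coneK (interior_subset Ku) u0); rewrite scalerBl.
have : S t x - b *: u @[t --> +oo] --> f x *: u - b *: u.
  by apply: cvgB => //; exact: cvg_cst.
apply: (closed_cvg K closedK).
by apply: filterS pinfty_ge0 => t; exact: xb.
Qed.

(** [S t] commutes with the semigroup and fixes the limit [f x *: u]. *)
Lemma limit_functional_invariant t x : 0 <= t -> f (S t x) = f x.
Proof.
move=> t0; apply: (scaler_left_inj u0).
apply: (cvg_unique (@norm_hausdorff _ X) (@fE _)).
have : S t (S s x) @[s --> +oo] --> S t (f x *: u).
  apply: (@continuous_cvg _ _ _ _ _ (S ^~ x) (S t)); first exact: cts_fun.
  exact: fE.
rewrite linearZ/= Su//; apply: cvg_trans; apply: near_eq_cvg.
by apply: filterS pinfty_ge0 => s s0; rewrite -!(orbitD semiS)// addrC.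
Qed.

Lemma limit_functional_dual : dual_cone K f.
Proof.
move=> x Kx; apply: limit_functional_ge0 => t t0.
by rewrite scale0r subr0; exact: (orbit_cone semiS).
Qed.

(** Once the trajectory dominates [e *: u], it does so forever, and [f] does
    not change along it. *)
Lemma limit_functional_gt0 x : K x -> x <> 0 -> 0 < f x.
Proof.
move=> Kx x0; have [r r0 Kr] := strictS Kx x0.
have [e e0 Ke] := interior_cone_subZ u Kr.
apply: (lt_le_trans e0); rewrite -(limit_functional_invariant x r0).
apply: limit_functional_ge0 => t t0.
have := orbit_cone semiS t0 (interior_subset Ke).
by rewrite linearB linearZ/= Su.
Qed.

Lemma orbit_mulrn_cvg t x : 0 < t -> S (t *+ n) x @[n --> \oo] --> f x *: u.
Proof.
move=> t0; have := @cvg_arithmetic R 0 _ t0 => tn.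
rewrite (_ : (fun n => _) = (S ^~ x) \o arithmetic 0 t); last first.
  by apply/funext => n /=; rewrite add0r.
exact: cvg_comp tn (@fE x).
Qed.

(** A fixed vector of [S t] is fixed by all its powers, hence equal to its own
    limit [f v *: u]. *)
Lemma simple_eigenvalue_orbit t : 0 < t -> simple_eigenvalue (S t) 1.
Proof.
move=> t0; split.
  by exists u; rewrite // /eigenspace_of/= scale1r Su// ltW.
exists u => //; apply/seteqP; split=> [v /= Sv|_ [c _ <-]]; last first.
  by rewrite /eigenspace_of/= linearZ/= Su ?ltW// scale1r.
exists (f v) => //.
apply: (cvg_unique (@norm_hausdorff _ X) (orbit_mulrn_cvg (x := v) t0)).
apply: cvg_near_cst; apply: nearW => n.
by rewrite (orbit_iter semiS _ (ltW t0) Sv) expr1n scale1r.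
Qed.

(** Dually, a functional [g] fixed by the adjoint is constant along the
    trajectory of [x] at multiples of [t], hence [g x = g (f x *: u)]. *)
Lemma simple_eigenvalue_adjoint t :
  0 < t -> simple_eigenvalue (adjoint (S t)) 1.
Proof.
move=> t0; have f0 : f != 0.
  apply/eqP => f0; have := limit_functional_unit; rewrite f0 => /eqP.
  by rewrite eq_sym oner_eq0.
have ff : adjoint (S t) f = f.
  by apply: clinear_eq => x; apply: limit_functional_invariant; exact: ltW.
split; first by exists f; rewrite // /eigenspace_of/= scale1r.
exists f => //; apply/seteqP; split=> [g /= Sg|_ [c _ <-]]; last first.
  by rewrite /eigenspace_of/= linearZ/= ff scale1r.
have gS n x : g (S (t *+ n) x) = g x.
  elim: n => [|n IH]; first by rewrite mulr0n (semigroup0 semiS).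
  rewrite mulrS (orbitD semiS) ?mulrn_wge0 ?ltW// -IH.
  by rewrite -[in RHS](scale1r g) -Sg.
exists (g u) => //; apply: clinear_eq => x.
have gx : g (S (t *+ n) x) @[n --> \oo] --> g (f x *: u).
  apply: (@continuous_cvg _ _ _ _ _ (fun n => S (t *+ n) x) g).
    exact: cts_fun.
  exact: orbit_mulrn_cvg.
have : g (f x *: u) = g x.
  apply: (cvg_unique (@norm_hausdorff _ R^o) gx).
  by apply: cvg_near_cst; apply: nearW => n; rewrite gS.
by rewrite linearZ/= => <-; exact: mulrC.
Qed.

End limit_functional_theory.

End compact_orbits.

Theorem theorem2 (R : realType) (X : completeNormedModType R) (K : set X)
    (S : R -> {clinear X -> X})
    (coneK : is_cone K) (closedK : closed K) (normalK : normal_cone K)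
    (intK : interior K !=set0)
    (semiS : positive_C0_semigroup K S)
    (hyp1 : forall x, K x -> x <> 0 ->
       exists2 t : R, 0 <= t & interior K (S t x))
    (hyp2 : forall x, K x -> precompact [set S t x | t in `[0, +oo[]) :
  exists A0 : {clinear X -> X},
    (forall x : X, S t x @[t --> +oo] --> A0 x) /\
    (A0 <> 0 ->
     exists (u : X) (f0 : {clinear X -> R^o}),
       [/\ interior K u, dual_cone K f0 & f0 <> 0] /\
       [/\ (* (i) *)
           [/\ forall t : R, 0 <= t -> S t u = u,
               forall t : R, 0 <= t -> adjoint (S t) f0 = f0
             & forall x, K x -> x <> 0 -> 0 < f0 x],
           (* (ii) *)
           A0 = tensor f0 u,
           (* (iii) *)
           forall f : {clinear X -> R^o},
             (adjoint (S t) f : weak_star X) @[t --> +oo] -->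
             (adjoint A0 f : weak_star X)
         & (* (iv) *)
           forall t : R, 0 < t ->
             simple_eigenvalue (S t) 1 /\ simple_eigenvalue (adjoint (S t)) 1]).
Proof.
have [to0|[u [Ku u0 Su]]] :=
    orbit_cvg0_or_fixed coneK closedK normalK intK semiS hyp1 hyp2.
  by exists 0; split.
have [f fE] := limit_functional coneK closedK normalK intK semiS hyp1 hyp2
  Ku u0 Su.
exists (tensor f u); split => // _; exists u, f.
have fu := limit_functional_unit u0 Su fE.
have fS t x (t0 : 0 <= t) := limit_functional_invariant semiS u0 Su fE x t0.
split.
  split=> //.
    exact: (@limit_functional_dual _ _ _ _ coneK closedK semiS _ _ Ku u0 fE).
  by move=> f0; move/eqP: fu; rewrite f0 eq_sym oner_eq0.
split.
- split=> // [t t0|x Kx x0]; first by apply: clinear_eq => x; exact: fS.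
  exact: (limit_functional_gt0 coneK closedK semiS hyp1 Ku u0 Su fE).
- by [].
- move=> g; apply: weak_star_cvg => x.
  apply: (@continuous_cvg _ _ _ _ _ (S ^~ x) g); first exact: cts_fun.
  exact: fE.
- move=> t t0; split.
    by have := simple_eigenvalue_orbit semiS u0 Su fE t0.
  by have := simple_eigenvalue_adjoint semiS u0 Su fE t0.
Qed.
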